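(* Let $n$ be a nonnegative integer. Then, up to integral equivalence, there are only finitely many smooth lattice polytopes (of any dimension) with $n$ lattice points.
   Context: Let $M\cong\mathbb{Z}^d$ be a lattice, $N=\mathrm{Hom}(M,\mathbb{Z})$, $M_{\mathbb{R}}=M\otimes\mathbb{R}$, $N_{\mathbb{R}}=N\otimes\mathbb{R}$. A lattice polytope $P\subset M_{\mathbb{R}}$ is the convex hull of finitely many points of $M$. Two lattice polytopes $P\subset M_{\mathbb{R}}$, $P'\subset M'_{\mathbb{R}}$ are integrally equivalent if there is an affine map $\mathrm{aff}\,P\to\mathrm{aff}\,P'$ mapping $M\cap\mathrm{aff}\,P$ bijectively onto $M'\cap\mathrm{aff}\,P'$ and $P$ onto $P'$. Up to integral equivalence polytopes are assumed full dimensional. The normal cone of $P$ at a vertex $u$ is $\sigma(P,u)=\{v\in N_{\mathbb{R}}:\langle u'-u,v\rangle\ge 0\ \forall u'\in P\}$. A cone is unimodular if its primitive minimal generators form a lattice basis. A full-dimensional lattice polytope is smooth if all its normal cones at vertices are unimodular. The lattice points of $P$ are the points of $P\cap M$. *)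

(* Defs.v *)
From HB Require Import structures.
From mathcomp Require Import all_boot all_order all_algebra.
From mathcomp Require Import mathcomp_extra boolp classical_sets functions.
From mathcomp Require Import cardinality reals convex.

Set Implicit Arguments.
Unset Strict Implicit.
Unset Printing Implicit Defensive.

Import Order.TTheory GRing.Theory Num.Theory.

Local Open Scope classical_set_scope.
Local Open Scope ring_scope.
Local Open Scope card_scope.

(* Coordinates are fixed: M = Z^d is the set of integral row vectors in
   M_R = R^d, and N = Hom(M, Z) is the set of integral column vectors, paired
   with M by matrix multiplication. *)

Definition lattice (R : realType) (d : nat) : set 'rV[R]_d :=
  range (map_mx intr : 'rV[int]_d -> 'rV[R]_d).

Definition pairing (R : realType) (d : nat) (u : 'rV[R]_d) (v : 'cV[R]_d) : R :=
  (u *m v) 0 0.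

Definition convex_hull (R : realType) (d : nat) (S : set 'rV[R]_d) :
    set 'rV[R]_d :=
  smallest (@convex_set R 'rV[R]_d) S.

Definition affine_set (R : realType) (d : nat) (A : set 'rV[R]_d) : Prop :=
  forall (x y : 'rV[R]_d) (t : R), A x -> A y -> A (t *: x + (1 - t) *: y).

Definition affine_hull (R : realType) (d : nat) (S : set 'rV[R]_d) :
    set 'rV[R]_d :=
  smallest (@affine_set R d) S.

Definition affine_on (R : realType) (d d' : nat) (A : set 'rV[R]_d)
    (f : 'rV[R]_d -> 'rV[R]_d') : Prop :=
  forall (x y : 'rV[R]_d) (t : R), A x -> A y ->
    f (t *: x + (1 - t) *: y) = t *: f x + (1 - t) *: f y.

Definition lattice_polytope (R : realType) (d : nat) (P : set 'rV[R]_d) : Prop :=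
  exists S : set 'rV[R]_d,
    [/\ finite_set S, S `<=` @lattice R d & P = convex_hull S].

Definition full_dimensional (R : realType) (d : nat) (P : set 'rV[R]_d) : Prop :=
  affine_hull P = setT.

(* The values of f outside the affine hull of P are irrelevant. *)
Definition integrally_equivalent (R : realType) (d d' : nat)
    (P : set 'rV[R]_d) (P' : set 'rV[R]_d') : Prop :=
  exists f : 'rV[R]_d -> 'rV[R]_d',
    [/\ affine_on (affine_hull P) f,
        f @` affine_hull P `<=` affine_hull P',
        set_bij (@lattice R d `&` affine_hull P)
                (@lattice R d' `&` affine_hull P') f
      & f @` P = P'].

(* A vertex is a zero-dimensional face: the unique minimizer on P of some
   linear functional. *)
Definition vertex (R : realType) (d : nat) (P : set 'rV[R]_d) (u : 'rV[R]_d) :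
    Prop :=
  P u /\ exists v : 'cV[R]_d,
    forall u' : 'rV[R]_d, P u' -> u' <> u -> pairing u v < pairing u' v.

Definition normal_cone (R : realType) (d : nat) (P : set 'rV[R]_d)
    (u : 'rV[R]_d) : set 'cV[R]_d :=
  [set v | forall u' : 'rV[R]_d, P u' -> 0 <= pairing (u' - u) v].

(* A finite family of k elements of N is given by the columns of G. *)
Definition cone_generated (R : realType) (d k : nat) (G : 'M[int]_(d, k)) :
    set 'cV[R]_d :=
  [set map_mx intr G *m c | c in [set c : 'cV[R]_k | forall i, 0 <= c i 0]].

(* This excludes v = 0, since 0 = 0 *: 0. *)
Definition primitive (d : nat) (v : 'cV[int]_d) : Prop :=
  forall (m : int) (w : 'cV[int]_d), v = m *: w -> m \is a GRing.unit.

(* For a strongly convex rational cone, such as the normal cone at a vertex of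
   a full-dimensional lattice polytope, G is unique up to the order of its
   columns. *)
Definition primitive_minimal_generators (R : realType) (d k : nat)
    (sigma : set 'cV[R]_d) (G : 'M[int]_(d, k)) : Prop :=
  [/\ forall j : 'I_k, primitive (col j G),
      cone_generated G = sigma
    & forall j : 'I_k, cone_generated (col' j G) <> sigma].

Definition lattice_basis (d k : nat) (G : 'M[int]_(d, k)) : Prop :=
  forall v : 'cV[int]_d, exists! c : 'cV[int]_k, v = G *m c.

Definition unimodular_cone (R : realType) (d : nat) (sigma : set 'cV[R]_d) :
    Prop :=
  exists (k : nat) (G : 'M[int]_(d, k)),
    primitive_minimal_generators sigma G /\ lattice_basis G.

Definition smooth_lattice_polytope (R : realType) (d : nat)
    (P : set 'rV[R]_d) : Prop :=
  [/\ lattice_polytope P, full_dimensional P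
    & forall u : 'rV[R]_d, vertex P u -> unimodular_cone (normal_cone P u)].

Definition has_lattice_points (R : realType) (d : nat) (P : set 'rV[R]_d)
    (n : nat) : Prop :=
  (P `&` @lattice R d) #= `I_n.

(* Main.v *)
Require Import Defs.
From HB Require Import structures.
From mathcomp Require Import all_boot all_order all_algebra.
From mathcomp Require Import zify ring lra.
From mathcomp Require Import mathcomp_extra boolp classical_sets functions.
From mathcomp Require Import cardinality reals convex interval_inference.

(* The edge directions e_1, ..., e_d at a vertex u of a smooth polytope P form a
   lattice basis, and in the coordinates of that basis based at u the polytope
   lies in the nonnegative orthant.  At the neighbour u' = u + l e_i the edge
   directions are -e_i and e_j + k_j e_i for j <> i: two nonnegative integer
   matrices inverse to each other are permutation matrices.  The lattice points
   on the segments [u, u'] and [u + e_j, u' + e_j + k_j e_i], both contained in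
   P, give |k_j| <= n, where n is the number of lattice points of P.  So a
   linear functional whose values on the e_j are bounded by K has values bounded
   by (n+1)K on the edge directions at u', and it increases by at most nK from u
   to u'.  The simplex method reaches the maximum of the functional on P after
   at most n increasing steps; applied to the coordinates at u this bounds P in
   a box depending only on n.  Since also d <= n, there are finitely many
   possibilities for the set of lattice points of P in these coordinates. *)

Set Implicit Arguments.
Unset Strict Implicit.
Unset Printing Implicit Defensive.

Import Order.TTheory GRing.Theory Num.Theory.

Local Open Scope classical_set_scope.
Local Open Scope ring_scope.

(** * Base changes between edge bases at adjacent vertices *)

Lemma mulz_eq1 (a b : int) : a * b = 1 -> a = 1 \/ a = -1.
Proof.
by move=> /(congr1 absz)/eqP; rewrite abszM muln_eq1 => /andP[/eqP a1 _]; lia.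
Qed.

(* A and B play the role of the base changes between the edge bases at two
   adjacent vertices, i being the direction of the common edge. *)
Lemma adjacent_bases d (A B : 'M[int]_d) (i : 'I_d) :
  A *m B = 1%:M ->
  (forall k m, m != i -> 0 <= A k m) ->
  (forall k, B i k <= 0) ->
  (forall m k, B i k = 0 -> 0 <= B m k) ->
  forall k, (forall m, A k m = - (m == i)%:R) \/
            exists2 j, j != i & forall m, m != i -> A k m = (m == j)%:R.
Proof.
move=> AB A_ge0 Bi_le0 B_ge0.
have ABE k k' : \sum_m A k m * B m k' = (k == k')%:R.
  by have := congr1 (fun M : 'M_d => M k k') AB; rewrite !mxE.
have BAE k k' : \sum_m B k m * A m k' = (k == k')%:R.
  by have := congr1 (fun M : 'M_d => M k k') (mulmx1C AB); rewrite !mxE.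
(* The entry (i, m) of B A is 0 and is a sum of nonpositive terms, so each term vanishes. *)
have offaxis k m : B i k < 0 -> m != i -> A k m = 0.
  move=> Bik mi; have /eqP := BAE i m.
  rewrite [i == m]eq_sym (negPf mi) -oppr_eq0 -sumrN psumr_eq0 => [|k' _]; last first.
    by rewrite -mulNr mulr_ge0 ?oppr_ge0 ?A_ge0.
  move=> /allP /(_ k (mem_index_enum _)); rewrite oppr_eq0 mulf_eq0.
  by rewrite (lt_eqF Bik) => /eqP.
move=> k; have [Bik|Bik] := eqVneq (B i k) 0; last first.
  left; have {}Bik : B i k < 0 by rewrite lt_neqAle Bik Bi_le0.
  have := ABE k k; rewrite eqxx (bigD1 i) //= big1 => [|m mi]; last first.
    by rewrite offaxis ?mul0r.
  move=> Aki m; have [->|mi] := eqVneq m i; last by rewrite offaxis ?oppr0.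
  by nia.
right.
have AB_ge0 k' m : B i k' = 0 -> 0 <= A k m * B m k'.
  move=> Bik'; have [->|mi] := eqVneq m i; first by rewrite Bik' mulr0.
  by rewrite mulr_ge0 ?A_ge0 ?B_ge0.
(* The diagonal entry 1 of A B is here a sum of nonnegative integers, so one term is 1 and the
   others are 0. *)
have /existsP[j ABj] : [exists j, A k j * B j k != 0].
  apply: contraT; rewrite negb_exists => /forallP AB0.
  have := ABE k k; rewrite eqxx big1 // => m _; apply/eqP.
  by have := AB0 m; rewrite negbK.
have ji : j != i by apply: contra_neq ABj => ->; rewrite Bik mulr0.
have := ABE k k; rewrite eqxx (bigD1 j) //=.
set rest : int := \sum_(m | _) _; rewrite mulr1n => ABjk.
have rest_ge0 : 0 <= rest by apply: sumr_ge0 => m _; exact: AB_ge0.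
have ABj_gt0 : 0 < A k j * B j k by rewrite lt_neqAle eq_sym ABj AB_ge0.
have Akj_ge0 := A_ge0 k j ji.
have rest0 : rest = 0 by lia.
have ABj1 : A k j * B j k = 1 by lia.
have Akj : A k j = 1.
  by case: (mulz_eq1 ABj1) => // AkjN1; rewrite AkjN1 in Akj_ge0.
exists j => // m mi; have [->|mj] := eqVneq m j; first by rewrite mulr1n; nia.
(* A nonzero [A k m] would kill every term of the entry (m, m) of B A: by [offaxis] where [B i k']
   is negative, and elsewhere because [A k m * B m k'] is 0. *)
apply: contra_eq (BAE m m) => Akm; rewrite eqxx big1 // => k' _; apply/eqP.
rewrite mulf_eq0; have [Bik'|Bik'] := eqVneq (B i k') 0; last first.
  by rewrite (offaxis k') ?eqxx ?orbT // lt_neqAle Bik' Bi_le0.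
apply/orP; left; suff : A k m * B m k' == 0 by rewrite mulf_eq0 (negPf Akm).
have [->|k'k] := eqVneq k' k.
  have /eqP := rest0; rewrite psumr_eq0 => [|? _]; last exact: AB_ge0.
  by move=> /allP /(_ m (mem_index_enum _)); rewrite mj.
have /eqP := ABE k k'; rewrite [k == _]eq_sym (negPf k'k) psumr_eq0 => [|? _].
  by move=> /allP /(_ m (mem_index_enum _)).
exact: AB_ge0.
Qed.

(** * Corners and the passage along an edge *)

Lemma mulmxnl (R : comPzRingType) m n p (A : 'M[R]_(m, n)) (B : 'M[R]_(n, p)) k :
  (A *+ k) *m B = (A *m B) *+ k.
Proof. by rewrite -!scaler_nat scalemxAl. Qed.

Lemma col_mulmx (R : pzSemiRingType) m n p (A : 'M[R]_(m, n)) (B : 'M[R]_(n, p)) j :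
  col j (A *m B) = A *m col j B.
Proof. by apply/colP => i; rewrite !mxE; apply: eq_bigr => k _; rewrite mxE. Qed.

(* V and L stand for the vertices and the lattice points of a polytope; the rows
   of E are the edge directions at p, and the columns of G the dual basis. *)
Definition corner (d : nat) (V L : 'rV[int]_d -> Prop) (p : 'rV[int]_d)
    (E G : 'M[int]_d) : Prop :=
  [/\ E *m G = 1%:M,
      forall q, L q -> forall j, 0 <= ((q - p) *m G) 0 j
    & forall j, exists2 l : nat, (0 < l)%N & V (p + row j E *+ l)].

Definition lattice_convex (d : nat) (L : 'rV[int]_d -> Prop) : Prop :=
  forall p e (l t : nat), (t <= l)%N -> L p -> L (p + e *+ l) -> L (p + e *+ t).

Definition at_most (T : eqType) (L : T -> Prop) (n : nat) : Prop :=
  forall s : seq T, uniq s -> (forall x, x \in s -> L x) -> (size s <= n)%N.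

(** The l + 1 points p + t e with t <= l are distinct and lie in L. *)
Lemma segment_length d (L : 'rV[int]_d -> Prop) n p e l :
  lattice_convex L -> at_most L n -> e != 0 -> L p -> L (p + e *+ l) ->
  (l < n)%N.
Proof.
move=> Lconv Ln e0 Lp Lpl.
have := Ln [seq p + e *+ t | t <- iota 0 l.+1].
rewrite size_map size_iota; apply.
  rewrite map_inj_uniq ?iota_uniq // => t t' /addrI et.
  have /rV0Pn[j ej] := e0; have := congr1 (fun v : 'rV_d => v 0 j) et.
  by rewrite !mulmxnE => /(mulrIn ej).
move=> x /mapP[t]; rewrite mem_iota add0n ltnS => /andP[_ tl] ->.
exact: Lconv tl Lp Lpl.
Qed.

Lemma corner_row_neq0 d (E G : 'M[int]_d) j : E *m G = 1%:M -> row j E != 0.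
Proof.
move=> EG; apply/eqP => Ej0; have := congr1 (fun M : 'M_d => row j M 0 j) EG.
by rewrite row_mul Ej0 mul0mx !mxE eqxx => /eqP; rewrite eq_sym oner_eq0.
Qed.

Lemma corner_point d (V L : 'rV[int]_d -> Prop) p E G j :
  lattice_convex L -> (forall q, V q -> L q) -> L p -> corner V L p E G ->
  L (p + row j E).
Proof.
move=> Lconv VL Lp [_ _ /(_ j)[l l0 /VL]].
by move=> /(Lconv p _ l 1%N l0 Lp); rewrite mulr1n.
Qed.

Lemma corner_dim d (V L : 'rV[int]_d -> Prop) n p E G :
  lattice_convex L -> (forall q, V q -> L q) -> at_most L n -> L p ->
  corner V L p E G -> (d <= n)%N.
Proof.
move=> Lconv VL Ln Lp cEG; have [EG _ _] := cEG.
have := Ln [seq p + row j E | j <- enum 'I_d].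
rewrite size_map size_enum_ord; apply.
  rewrite map_inj_uniq ?enum_uniq // => i j /addrI eij.
  have := congr1 (fun v : 'rV_d => (v *m G) 0 j) eij.
  rewrite -!row_mul EG !mxE eqxx; case: eqVneq => // _.
by move=> x /mapP[j _ ->]; exact: corner_point cEG.
Qed.

Lemma adjacent_corner d (V L : 'rV[int]_d -> Prop) n p (E G E' G' : 'M[int]_d)
    (i : 'I_d) (l : nat) :
  lattice_convex L -> (forall q, V q -> L q) -> at_most L n ->
  V p -> corner V L p E G ->
  (0 < l)%N -> V (p + row i E *+ l) ->
  corner V L (p + row i E *+ l) E' G' ->
  forall k, row k E' = - row i E \/
    exists j (a : int), `|a| <= n%:Z /\ row k E' = row j E + a *: row i E.
Proof.
move=> Lconv VL Ln Vp cEG l0 Vp' cEG'.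
have [EG yge Vadj] := cEG; have [EG' yge' Vadj'] := cEG'.
have GE := mulmx1C EG; have GE' := mulmx1C EG'.
set p' := p + row i E *+ l in Vp' cEG' yge' Vadj' *.
set A := E' *m G; set B := E *m G'.
have AB : A *m B = 1%:M by rewrite mulmxA -(mulmxA E') GE mulmx1.
have AE : E' = A *m E by rewrite -mulmxA GE mulmx1.
have rowA k m : (row k E' *m G) 0 m = A k m by rewrite -row_mul mxE.
have rowB k m : (row k E *m G') 0 m = B k m by rewrite -row_mul mxE.
have rowEG k m : (row k E *m G) 0 m = (k == m)%:R by rewrite -row_mul EG !mxE.
have coord t k m : ((p' + row k E' *+ t - p) *m G) 0 m =
    (i == m)%:R *+ l + A k m *+ t.
  rewrite /p' -(addrA p) (addrC p) addrK mulmxDl !mulmxnl.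
  by rewrite mxE !mulmxnE rowEG rowA.
(* The neighbours of p' in the coordinates at p, then p and its neighbours in the coordinates at p',
   give the sign conditions of [adjacent_bases]. *)
have A_ge0 k m : m != i -> 0 <= A k m.
  move=> mi; have [t t0 /VL /yge /(_ m)] := Vadj' k.
  by rewrite coord eq_sym (negPf mi) mul0rn add0r pmulrn_lge0.
have Bi_le0 k : B i k <= 0.
  have := yge' _ (VL _ Vp) k; rewrite /p' opprD addNKr mulNmx mulmxnl.
  by rewrite mxE mulmxnE rowB oppr_ge0 pmulrn_lle0.
have B_ge0 m k : B i k = 0 -> 0 <= B m k.
  have [t t0 /VL /yge' /(_ k)] := Vadj m => /[swap] Bik.
  rewrite /p' opprD addrACA subrr add0r mulmxBl !mulmxnl mxE [X in _ + X]mxE.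
  by rewrite !mulmxnE !rowB Bik mul0rn subr0 pmulrn_lge0.
move=> k; have rowE : row k E' = \sum_m A k m *: row m E.
  by rewrite {1}AE row_mul mulmx_sum_row; apply: eq_bigr => m _; rewrite mxE.
have [Aki|[j ji Akj]] := adjacent_bases AB A_ge0 Bi_le0 B_ge0 k.
  left; rewrite rowE (bigD1 i) //= big1 => [|m mi]; last first.
    by rewrite Aki (negPf mi) oppr0 scale0r.
  by rewrite Aki eqxx scaleN1r addr0.
right; exists j, (A k i).
have {}rowE : row k E' = row j E + A k i *: row i E.
  rewrite rowE (bigD1 i) //= (bigD1 j) //= big1 => [|m /andP[mi mj]]; last first.
    by rewrite Akj // (negPf mj) scale0r.
  by rewrite (Akj j) // eqxx scale1r addr0 addrC.
split=> //.
have Lj := corner_point j Lconv VL (VL _ Vp) cEG.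
have Lk := corner_point k Lconv VL (VL _ Vp') cEG'.
have l_n := segment_length Lconv Ln (corner_row_neq0 i EG) (VL _ Vp) (VL _ Vp').
(* The segment from p + e_j to p' + e'_k has direction e_i and length l + [A k i], a coordinate at p
   and so nonnegative; like l, it is below n. *)
have := yge _ Lk i; rewrite -[row k E']mulr1n coord eqxx mulr1n natz.
case lt: (l%:Z + A k i) => [t|//] _.
have t_n : (t < n)%N.
  apply: (segment_length Lconv Ln (corner_row_neq0 i EG) Lj).
  have -> : row i E *+ t = row i E *+ l + A k i *: row i E; last first.
    by rewrite addrACA -addrA -rowE addrA.
  by rewrite -!scaler_nat -scalerDl !natz lt.
lia.
Qed.

(** * The simplex method and the bounding box *)

(* Bounds the increase of a linear functional in m steps of the simplex method,
   K being a bound on its values on the edge directions at the start. *)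
Fixpoint gap (n m K : nat) : nat :=
  if m is m'.+1 then (n * K + gap n m' (n.+1 * K))%N else 0%N.

(** Induction on the number m of steps left. The list [s] collects points of L already passed; each
    step adds p to it, and its size cannot exceed n. *)
Lemma simplex_bound d (V L : 'rV[int]_d -> Prop) n (c : 'cV[int]_d) :
  lattice_convex L -> (forall q, V q -> L q) -> at_most L n ->
  (forall p, V p -> exists E G, corner V L p E G) ->
  forall m K p E G (s : seq 'rV[int]_d),
    V p -> corner V L p E G -> (forall j, `|(row j E *m c) 0 0| <= K%:Z) ->
    uniq s -> (forall x, x \in s -> L x /\ (x *m c) 0 0 < (p *m c) 0 0) ->
    (size s + m)%N = n ->
  forall q, L q -> (q *m c) 0 0 <= (p *m c) 0 0 + (gap n m K)%:Z.
Proof.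
move=> Lconv VL Ln Vcorner; elim=> [|m IHm] K p E G s Vp cEG EK s_uniq s_lt sn.
  have ps_uniq : uniq (p :: s).
    rewrite /= s_uniq andbT; apply/negP => /s_lt[_].
    by rewrite ltxx.
  have := Ln _ ps_uniq; rewrite /= -sn addn0 ltnn => ps_n.
  suff : false by [].
  by apply: ps_n => x; rewrite inE => /predU1P[->|/s_lt[]//]; exact: VL.
move=> q Lq; have [EG yge Vadj] := cEG.
have [[j ej_gt0]|e_le0] := pselect (exists j, 0 < (row j E *m c) 0 0); last first.
  apply: (@le_trans _ _ ((p *m c) 0 0)); last by rewrite lerDl.
  rewrite -subr_le0.
  (* No edge increases the functional, and q - p is a nonnegative combination of the edges, so p is
     a maximum. *)
  have -> : (q *m c) 0 0 - (p *m c) 0 0 =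
      \sum_j ((q - p) *m G) 0 j * (row j E *m c) 0 0.
    transitivity (((q - p) *m c) 0 0).
      by rewrite mulmxBl [in RHS]mxE [X in _ = _ + X]mxE.
    rewrite -[q - p in LHS]mulmx1 -(mulmx1C EG) mulmxA -mulmxA mxE.
    by apply: eq_bigr => j _; rewrite -row_mul [X in _ = _ * X]mxE.
  apply: sumr_le0 => j _; apply: mulr_ge0_le0; first exact: yge.
  by rewrite leNgt; apply/negP => ej_gt0; apply: e_le0; exists j.
have [l l0 Vp'] := Vadj j; have [E' [G' cEG']] := Vcorner _ Vp'.
have l_n := segment_length Lconv Ln (corner_row_neq0 j EG) (VL _ Vp) (VL _ Vp').
have fp' : ((p + row j E *+ l) *m c) 0 0 =
    (p *m c) 0 0 + (row j E *m c) 0 0 *+ l.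
  by rewrite mulmxDl mulmxnl mxE mulmxnE.
have E'K k : `|(row k E' *m c) 0 0| <= (n.+1 * K)%:Z.
  case: (adjacent_corner Lconv VL Ln Vp cEG l0 Vp' cEG' k) => [->|].
    by rewrite mulNmx mxE normrN (le_trans (EK j)) // lez_nat leq_pmull.
  move=> [i [a [a_n ->]]]; rewrite mulmxDl -scalemxAl mxE [X in _ + X]mxE.
  rewrite (le_trans (ler_normD _ _)) // normrM mulSn PoszD lerD //.
  by rewrite PoszM ler_pM.
have s'_uniq : uniq (p :: s).
  by rewrite /= s_uniq andbT; apply/negP => /s_lt[_]; rewrite ltxx.
have p_lt : (p *m c) 0 0 < ((p + row j E *+ l) *m c) 0 0.
  by rewrite fp' ltrDl pmulrn_lgt0.
apply: (le_trans (IHm _ _ _ _ (p :: s) Vp' cEG' E'K s'_uniq _ _ q Lq)).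
- move=> x; rewrite inE => /predU1P[->|/s_lt[Lx x_lt]]; split=> //.
    exact: VL.
  exact: lt_trans p_lt.
- by rewrite -sn addSnnS.
rewrite fp' -addrA lerD2l /= PoszD lerD2r PoszM.
have := EK j; rewrite gtr0_norm // => ejK.
rewrite -mulr_natl natz ler_pM // ?ltW //.
Qed.

(** The j-th coordinate is the functional given by column j of G. Its values on the edges at p are 0
    and 1, whence K = 1, and no point has been passed yet, whence m = n. *)
Lemma corner_box d (V L : 'rV[int]_d -> Prop) n p E G :
  lattice_convex L -> (forall q, V q -> L q) -> at_most L n ->
  (forall p, V p -> exists E G, corner V L p E G) ->
  V p -> corner V L p E G ->
  forall q, L q -> forall j, 0 <= ((q - p) *m G) 0 j <= (gap n n 1)%:Z.
Proof.
move=> Lconv VL Ln Vcorner Vp cEG q Lq j; have [EG yge _] := cEG.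
rewrite yge //= mulmxBl mxE [X in _ + X]mxE lerBlDl.
have colE v : (v *m G) 0 j = (v *m col j G) 0 0 
  by rewrite -col_mulmx [RHS]mxE.
rewrite !colE.
apply: (simplex_bound Lconv VL Ln Vcorner Vp cEG (s := [::])) => //.
by move=> k; rewrite -colE -row_mul EG !mxE; case: eqVneq.
Qed.

(** * Convex hulls and vertices over the reals *)

Local Notation toR := (map_mx intr).

Lemma convex_setP (R : realType) d (A : set 'rV[R]_d) :
  convex_set A <->
  forall x y t, 0 <= t -> t <= 1 -> A x -> A y -> A (t *: x + (1 - t) *: y).
Proof.
split=> [Aconv x y t t0 t1 Ax Ay|Aconv x y l /set_mem Ax /set_mem Ay].
  by have /set_mem := Aconv x y (Itv01 t0 t1) (mem_set Ax) (mem_set Ay).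
by apply/mem_set/Aconv.
Qed.

Lemma convex_hull_convex (R : realType) d (S : set 'rV[R]_d) :
  convex_set (convex_hull S).
Proof.
apply/convex_setP => x y t t0 t1 Px Py A [Aconv SA].
by apply: (convex_setP A).1 => //; [exact: Px|exact: Py].
Qed.

Lemma sub_convex_hull (R : realType) d (S : set 'rV[R]_d) : S `<=` convex_hull S.
Proof. exact: sub_smallest. Qed.

Lemma pairing_conv (R : realType) d (x y : 'rV[R]_d) v t :
  pairing (t *: x + (1 - t) *: y) v = t * pairing x v + (1 - t) * pairing y v.
Proof. by rewrite /pairing mulmxDl -!scalemxAl mxE; congr (_ + _); rewrite mxE. Qed.

(** The point u together with the open half-space where v exceeds its value at u is convex. *)
Lemma hull_vertex (R : realType) d (S : set 'rV[R]_d) u v :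
  S u -> (forall x, S x -> x <> u -> pairing u v < pairing x v) ->
  vertex (convex_hull S) u.
Proof.
move=> Su umin; split; first exact: sub_convex_hull.
exists v => x Px xu.
suff : [set x | x = u \/ pairing u v < pairing x v] x by case.
apply: smallest_sub Px => [|y Sy]; last first.
  by have [->|yu] := pselect (y = u); [left|right; exact: umin].
apply/convex_setP => y z t t0 t1 /=.
have [->|t_neq0] := eqVneq t 0; first by rewrite scale0r add0r subr0 scale1r.
have [->|t_neq1] := eqVneq t 1; first by rewrite subrr scale0r addr0 scale1r.
have {t0 t_neq0}t0 : 0 < t by rewrite lt_neqAle eq_sym t_neq0.
have {t1 t_neq1}t1 : t < 1 by rewrite lt_neqAle t_neq1.
rewrite pairing_conv => -[->|xv] [->|yv].
- by left; rewrite -scalerDl addrC subrK scale1r.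
- by right; nra.
- by right; nra.
- by right; nra.
Qed.

Lemma halfspace_hull (R : realType) d (S : set 'rV[R]_d) v (a : R) :
  (forall x, S x -> a <= pairing x v) ->
  forall x, convex_hull S x -> a <= pairing x v.
Proof.
move=> Sa; apply: smallest_sub => //; apply/convex_setP => x y t t0 t1 xa ya.
rewrite /= in xa ya *; rewrite pairing_conv; nra.
Qed.

Lemma map_intr_inj (R : realType) m n :
  injective (map_mx intr : 'M[int]_(m, n) -> 'M[R]_(m, n)).
Proof.
move=> x y xy; apply/matrixP => i j.
by have := congr1 (fun M : 'M_(m, n) => M i j) xy; rewrite !mxE => /intr_inj.
Qed.

Lemma lattice_polytopeP (R : realType) d (P : set 'rV[R]_d) :
  lattice_polytope P -> exists s : seq 'rV[int]_d,
    P = convex_hull (toR @` [set` s]).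
Proof.
move=> [S [/finite_seqP[s ->] Slat ->]].
exists [seq map_mx Num.floor x | x <- s]; congr convex_hull.
have floorsK x : x \in s -> toR (map_mx Num.floor x) = x.
  by move=> /Slat[y _ <-]; congr map_mx; apply/matrixP => i j; rewrite !mxE intrKfloor.
apply/seteqP; split=> [x xs|_ [_ /mapP[x xs ->] <-]]; last first.
  by rewrite floorsK.
by exists (map_mx Num.floor x); [apply/mapP; exists x|exact: floorsK].
Qed.

Lemma convex_set_lattice_convex (R : realType) d (P : set 'rV[R]_d) :
  convex_set P -> lattice_convex (fun p : 'rV[int]_d => P (toR p)).
Proof.
move=> /convex_setP Pconv p e l t tl Pp Ppl.
have [l0|l0] := posnP l.
  by move: tl; rewrite l0 leqn0 => /eqP ->; rewrite mulr0n addr0.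
have l0R : (l%:R : R) != 0 by rewrite pnatr_eq0 -lt0n.
have -> : toR (p + e *+ t) = (t%:R / l%:R) *: toR (p + e *+ l) +
    (1 - t%:R / l%:R) *: toR p :> 'rV[R]_d.
  apply/rowP => j; rewrite !(mulmxnE, mxE) !rmorphD /= !rmorphMn /=.
  by rewrite -[_ *+ l]mulr_natr -[_ *+ t]mulr_natr; field.
apply: Pconv => //.
by rewrite ler_pdivrMr ?ltr0n // mul1r ler_nat.
Qed.

Lemma seq_argmin (T : eqType) (h : T -> int) (s : seq T) : s != [::] ->
  exists2 x, x \in s & forall y, y \in s -> h x <= h y.
Proof.
elim: s => // a [|b s] IHs _.
  by exists a => [|y]; rewrite inE => // /eqP ->.
have [//|x xs xmin] := IHs; have [ax|xa] := lerP (h a) (h x).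
  exists a => [|y]; first by rewrite inE eqxx.
  by rewrite inE => /predU1P[->//|/xmin]; exact: le_trans.
exists x => [|y]; first by rewrite inE xs orbT.
by rewrite inE => /predU1P[->|/xmin//]; exact: ltW.
Qed.

Lemma pairing_intr (R : realType) d (x : 'rV[int]_d) (v : 'cV[int]_d) :
  pairing (toR x : 'rV[R]_d) (toR v) = ((x *m v) 0 0)%:~R.
Proof. by rewrite /pairing -map_mxM mxE. Qed.

(** A point p of s of largest norm is a vertex: expanding |x - p|^2 > 0 shows that p is the strict
    minimum of -<x, p>. *)
Lemma exists_vertex (R : realType) d (s : seq 'rV[int]_d) : s != [::] ->
  exists p : 'rV[int]_d,
    vertex (convex_hull (toR @` [set` s] : set 'rV[R]_d)) (toR p).
Proof.
move=> /(seq_argmin (fun x => - (x *m x^T) 0 0))[p ps pmax]; exists p.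
apply: (@hull_vertex _ _ _ _ (toR (- p^T))); first by exists p.
move=> _ [x xs <-] xp; rewrite !pairing_intr ltr_int.
have {}xp : x - p != 0 by rewrite subr_eq0; apply: contra_not_neq xp => ->.
have : 0 < ((x - p) *m (x - p)^T) 0 0.
  have [j xpj] := rV0Pn _ xp; rewrite mxE (bigD1 j) //= [_^T _ _]mxE ltr_pwDl //.
    by rewrite -expr2 exprn_even_gt0.
  by apply: sumr_ge0 => k _; rewrite [_^T _ _]mxE -expr2 sqr_ge0.
have px : (p *m x^T) 0 0 = (x *m p^T) 0 0.
  by rewrite -[p in LHS]trmxK -trmx_mul [LHS]mxE.
have := pmax _ xs; rewrite linearB /= mulmxBl !mulmxBr !mulmxN.
have addE (A B : 'M[int]_1) : (A + B) 0 0 = A 0 0 + B 0 0 by rewrite mxE.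
have oppE (A : 'M[int]_1) : (- A) 0 0 = - A 0 0 by rewrite mxE.
rewrite !(addE, oppE) px.
by move: ((x *m p^T) 0 0) ((p *m p^T) 0 0) ((x *m x^T) 0 0) => a b c; lia.
Qed.

(** * From unimodular normal cones to corners *)

Lemma lattice_basis_inverse d k (G : 'M[int]_(d, k)) :
  lattice_basis G -> exists E, G *m E = 1%:M /\ E *m G = 1%:M.
Proof.
move=> Gbasis.
have Ginj (x y : 'cV_k) : G *m x = G *m y -> x = y.
  have [z [_ zuniq]] := Gbasis (G *m x) => Gxy.
  by rewrite -(zuniq x erefl) -(zuniq y Gxy).
have Gsurj (j : 'I_d) : exists c : 'cV_k, delta_mx j 0 = G *m c.
  by have [c [cE _]] := Gbasis (delta_mx j 0); exists c.
have [c cE] := boolp.choice Gsurj.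
pose E := \matrix_(i, j) c j i 0; exists E.
have GE : G *m E = 1%:M.
  apply/matrixP => i j; have := congr1 (fun M : 'cV_d => M i 0) (cE j).
  rewrite !mxE andbT => ->; apply: eq_bigr => m _; by rewrite !mxE.
split=> //; apply/matrixP => i j.
have colE : col j (E *m G) = col j 1%:M.
  by apply: Ginj; rewrite -?col_mulmx mulmxA GE mul1mx mulmx1.
by have := congr1 (fun M : 'cV_k => M i 0) colE; rewrite ![col _ _ _ _]mxE.
Qed.

Lemma unimodular_cone_dual (R : realType) d (sigma : set 'cV[R]_d) :
  unimodular_cone sigma ->
  exists E G : 'M[int]_d, E *m G = 1%:M /\ cone_generated G = sigma.
Proof.
move=> [k [G [[_ Gsigma _]]]] /lattice_basis_inverse[E [GE EG]].
have kd : k = d by apply/eqP; rewrite eqn_leq (mulmx1_min GE) (mulmx1_min EG).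
by case: _ / kd in sigma G Gsigma E GE EG *; exists E, G.
Qed.

(* The coordinates at p are nonnegative on s, so for large C the functional
   C * (sum of the coordinates m <> j) - (coordinate j) is positive at the
   points of s off the j-th axis; hence its minimum is attained at a single
   point, the furthest one on that axis. *)
Lemma vertex_corner (R : realType) d (s : seq 'rV[int]_d) (p : 'rV[int]_d) :
  let P := convex_hull (toR @` [set` s]) : set 'rV[R]_d in
  unimodular_cone (normal_cone P (toR p)) ->
  exists E G, corner (fun q => vertex P (toR q)) (fun q => P (toR q)) p E G.
Proof.
move=> P /unimodular_cone_dual[E [G [EG coneG]]]; exists E, G.
have GE := mulmx1C EG.
have yge q : P (toR q) -> forall j, 0 <= ((q - p) *m G) 0 j.
  move=> Pq j.
  have : normal_cone P (toR p) (toR (col j G)).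
    rewrite -coneG; exists (delta_mx j 0) => /=; first by move=> i; rewrite mxE ler0n.
    by rewrite colE map_mxM map_delta_mx.
  move=> /(_ _ Pq); rewrite -map_mxB pairing_intr ler0z -col_mulmx.
  by rewrite [X in 0 <= X -> _]mxE.
split=> // j; pose y (x : 'rV[int]_d) : 'rV[int]_d := (x - p) *m G.
have yK x : p + y x *m E = x by rewrite -mulmxA GE mulmx1 addrC subrK.
have sP x : x \in s -> P (toR x) by move=> xs; apply: sub_convex_hull; exists x.
have y_ge0 x m : x \in s -> 0 <= y x 0 m by move=> /sP/yge; exact.
have [C C_gt] : exists C : int, forall x, x \in s -> y x 0 j < C.
  have [s0|s_neq0] := eqVneq s [::].
    by exists 0 => x; rewrite s0.
  have [x _ xmin] := seq_argmin (fun x => - y x 0 j) s_neq0.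
  by exists (y x 0 j + 1) => z /xmin; rewrite lerN2 ltzD1.
pose c : 'cV[int]_d := \col_m (if m == j then -1 else C).
pose h (x : 'rV[int]_d) : int := ((x - p) *m (G *m c)) 0 0.
have hE x : h x = - y x 0 j + C * \sum_(m | m != j) y x 0 m.
  rewrite /h mulmxA mxE (bigD1 j) //= [c j 0]mxE eqxx mulrN1 mulr_sumr; congr (_ + _).
  by apply: eq_bigr => m mj; rewrite [c m 0]mxE (negPf mj) mulrC.
(* If [off] were positive, then [h x] would be at least C - [y x 0 j], which is positive. *)
have axis x : x \in s -> h x <= 0 -> x = p + row j E *+ absz (y x 0 j) /\ h x = - y x 0 j.
  move=> xs; rewrite hE; set off := \sum_(m | _) _ => h_le0.
  have off_ge0 : 0 <= off by apply: sumr_ge0 => m _; exact: y_ge0.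
  have yj_ge0 := y_ge0 _ j xs; have yj_lt := C_gt _ xs.
  have off0 : off = 0 by nia.
  rewrite off0 mulr0 addr0; split=> //; rewrite -{1}(yK x); congr (_ + _).
  rewrite mulmx_sum_row (bigD1 j) //= big1 ?addr0 => [|m mj]; last first.
    move/eqP: off0; rewrite psumr_eq0 => [|k _]; last exact: y_ge0.
    by move=> /allP /(_ m (mem_index_enum _)); rewrite mj => /eqP ->; rewrite scale0r.
  by rewrite -scaler_nat natz gez0_abs.
have hR x : pairing (toR x - toR p) (toR (G *m c)) = (h x)%:~R :> R.
  by rewrite -map_mxB pairing_intr.
(* Otherwise G c would lie in the normal cone, which is generated by the columns of G, and c would
   have no negative entry; but its j-th entry is -1. *)
have [x xs hx_lt0] : exists2 x, x \in s & h x < 0.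
  apply: contrapT => h_ge0.
  have [c' c'_ge0 Gc'] : cone_generated G (toR (G *m c) : 'cV[R]_d).
    rewrite coneG => u Pu; rewrite /pairing mulmxBl mxE [X in _ + X]mxE subr_ge0.
    move: u Pu; apply: halfspace_hull => _ [x xs <-].
    rewrite -subr_ge0; have := hR x.
    rewrite /pairing mulmxBl mxE [X in _ + X]mxE => ->.
    by rewrite ler0z leNgt; apply/negP => hx; apply: h_ge0; exists x.
  have := c'_ge0 j; have := congr1 (mulmx (toR E)) Gc'.
  rewrite mulmxA -!map_mxM mulmxA EG mul1mx map_mx1 mul1mx => ->.
  by rewrite !mxE eqxx ler0z.
have s_neq0 : s != [::] by apply: contraTneq xs => ->.
have [z zs zmin] := seq_argmin h s_neq0.
have hz_lt0 : h z < 0 by exact: le_lt_trans (zmin _ xs) hx_lt0.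
have [zE hzE] := axis z zs (ltW hz_lt0).
exists (absz (y z 0 j)).
  by rewrite absz_gt0; apply: contraTneq hz_lt0 => yz0; rewrite hzE yz0.
rewrite -zE; apply: (@hull_vertex _ _ _ _ (toR (G *m c))); first by exists z.
have hB x' : h x' = (x' *m (G *m c)) 0 0 - (p *m (G *m c)) 0 0.
  by rewrite /h mulmxBl mxE [X in _ + X]mxE.
move=> _ [w ws <-] wz; rewrite !pairing_intr ltr_int.
rewrite -(ltrD2r (- (p *m (G *m c)) 0 0)) -!hB lt_neqAle zmin // andbT.
apply/eqP => hzw; have [|wE hwE] := axis w ws; first by rewrite -hzw ltW.
apply: wz; rewrite wE [in RHS]zE; congr (toR (_ + _ *+ absz _)).
by apply: oppr_inj; rewrite -hwE -hzE.
Qed.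

(** * Finite codes for polytopes in a box *)

Lemma at_most_lattice_points (R : realType) d (P : set 'rV[R]_d) n :
  has_lattice_points P n -> at_most (fun q : 'rV[int]_d => P (toR q)) n.
Proof.
move=> Pn s s_uniq sP; rewrite -card_le_II -(card_le_eqr Pn).
pose f i : 'rV[R]_d := toR (nth 0 s i).
have f_inj : {in `I_(size s) &, injective f}.
  move=> i j /set_mem i_s /set_mem j_s /map_intr_inj /eqP.
  by rewrite nth_uniq // => /eqP.
rewrite -(card_le_eql (inj_card_eq f_inj)); apply: subset_card_le.
by move=> _ [i i_s <-]; split; [exact/sP/mem_nth|exists (nth 0 s i)].
Qed.

(** The bound concerns the generating points alone: they determine P, hence so do the lattice points
    of P in the box. *)
Definition framed (R : realType) (d C : nat) (P : set 'rV[R]_d)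
    (p : 'rV[int]_d) (E G : 'M[int]_d) : Prop :=
  E *m G = 1%:M /\
  exists2 s : seq 'rV[int]_d, P = convex_hull (toR @` [set` s]) &
    forall x, x \in s -> forall j, 0 <= ((x - p) *m G) 0 j <= C%:Z.

Lemma smooth_framed (R : realType) d (P : set 'rV[R]_d) n :
  smooth_lattice_polytope P -> has_lattice_points P n ->
  (d <= n)%N /\ exists p E G, framed (gap n n 1) P p E G.
Proof.
move=> [/lattice_polytopeP[s Ps] Pfull Psmooth] /at_most_lattice_points Ln.
have Lconv : lattice_convex (fun q : 'rV[int]_d => P (toR q)).
  by apply: convex_set_lattice_convex; rewrite Ps; exact: convex_hull_convex.
have VL (q : 'rV[int]_d) : vertex P (toR q) -> P (toR q) by case.
(* The empty set is affine, so it is not full dimensional, even for d = 0. *)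
have s_neq0 : s != [::].
  apply/eqP => s0; suff : affine_hull P `<=` set0.
    by move=> /(_ 0); rewrite Pfull; exact.
  apply: smallest_sub => [x y t []//|]; rewrite Ps s0.
  by apply: smallest_sub => [|_ [x]//]; apply/convex_setP => x y t _ _ [].
have Vcorner (q : 'rV[int]_d) : vertex P (toR q) -> exists E G,
    corner (fun q => vertex P (toR q)) (fun q => P (toR q)) q E G.
  by move=> /Psmooth; rewrite Ps; exact: vertex_corner.
have [p Vp] := @exists_vertex R d s s_neq0; rewrite -Ps in Vp.
have [E [G cEG]] := Vcorner _ Vp; have [EG _ _] := cEG.
split; first exact: corner_dim Lconv VL Ln (VL _ Vp) cEG.
exists p, E, G; split=> //; exists s => // x xs.
apply: (corner_box Lconv VL Ln Vcorner Vp cEG).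
by rewrite Ps; apply: sub_convex_hull; exists x.
Qed.

(** The coordinates are ordinals so that the codes form a finite type. *)
Definition box_points (R : realType) (d C : nat) (P : set 'rV[R]_d)
    (p : 'rV[int]_d) (E : 'M[int]_d) : {set 'rV['I_C.+1]_d} :=
  [set y | `[< P (toR (p + map_mx (fun i : 'I_C.+1 => Posz i) y *m E)) >]].

Lemma affine_conv (R : realType) m n (q : 'rV[R]_m) (M : 'M[R]_(m, n)) r x y t :
  (t *: x + (1 - t) *: y - q) *m M + r =
  t *: ((x - q) *m M + r) + (1 - t) *: ((y - q) *m M + r).
Proof.
have conv_id (W : lmodType R) (w : W) : w = t *: w + (1 - t) *: w.
  by rewrite -scalerDl addrC subrK scale1r.
rewrite [q in LHS]conv_id [r in LHS]conv_id opprD addrACA -!scalerBr.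
by rewrite mulmxDl -!scalemxAl addrACA -!scalerDr.
Qed.

(** The map carries coordinates at p to the same coordinates at p'. Generators of P lie in the box,
    so equal codes send them into P'; convexity of P' does the rest. *)
Lemma framed_sub (R : realType) d C (P P' : set 'rV[R]_d) p p' E E' G G' :
  framed C P p E G -> framed C P' p' E' G' ->
  box_points C P p E = box_points C P' p' E' ->
  forall x, P x -> P' ((x - toR p) *m toR (G *m E') + toR p').
Proof.
move=> [EG [s Ps s_box]] [_ [s' Ps' _]] PP' x Px.
have P'conv : convex_set P' by rewrite Ps'; exact: convex_hull_convex.
suff : [set x | P' ((x - toR p) *m toR (G *m E') + toR p')] x by [].
rewrite Ps in Px; apply: smallest_sub Px => [|_ [z zs <-]] /=.
  apply/convex_setP => a b t t0 t1 Pa Pb.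
  have := (convex_setP _).1 P'conv _ _ t t0 t1 Pa Pb.
  by rewrite /= affine_conv.
pose y : 'rV['I_C.+1]_d := \row_j inord (absz (((z - p) *m G) 0 j)).
have yE : map_mx (fun i : 'I_C.+1 => Posz i) y = (z - p) *m G.
  apply/rowP => j; have /andP[y_ge0 y_le] := s_box z zs j.
  rewrite mxE [y _ _]mxE inordK ?gez0_abs //.
  by rewrite ltnS -lez_nat gez0_abs.
have : y \in box_points C P p E.
  rewrite inE; apply/asboolP; rewrite yE -mulmxA (mulmx1C EG) mulmx1 addrC subrK.
  by rewrite Ps; apply: sub_convex_hull; exists z.
rewrite PP' inE => /asboolP; rewrite yE -mulmxA.
by rewrite -map_mxB -map_mxM -map_mxD addrC.
Qed.

(** G E' and G' E are inverse integer matrices, so [framed_sub] applies in both directions. *)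
Lemma framed_equivalent (R : realType) d C (P P' : set 'rV[R]_d) p p' E E' G G' :
  full_dimensional P -> full_dimensional P' ->
  framed C P p E G -> framed C P' p' E' G' ->
  box_points C P p E = box_points C P' p' E' ->
  integrally_equivalent P P'.
Proof.
move=> Pfull P'full frP frP' PP'.
have [[EG _] [EG' _]] := (frP, frP').
pose f (q q' : 'rV[int]_d) (M : 'M[int]_d) (x : 'rV[R]_d) :=
  (x - toR q) *m toR M + toR q'.
have fK q q' M M' : M *m M' = 1%:M -> cancel (f q q' M) (f q' q M').
  move=> MM' x; rewrite /f addrK -mulmxA -map_mxM MM' map_mx1 mulmx1 subrK //.
have fint q q' M (x : 'rV[int]_d) : f q q' M (toR x) = toR ((x - q) *m M + q').
  by rewrite map_mxD map_mxM map_mxB.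
have GE := mulmx1C EG; have GE' := mulmx1C EG'.
have K1 : G *m E' *m (G' *m E) = 1%:M.
  by rewrite mulmxA -(mulmxA G) EG' mulmx1 GE.
have K2 : G' *m E *m (G *m E') = 1%:M by exact: mulmx1C.
exists (f p p' (G *m E')); rewrite Pfull P'full !setIT; split=> //.
- by move=> x y t _ _; rewrite /f affine_conv.
- split.
  + by move=> _ [x _ <-]; rewrite fint; exists ((x - p) *m (G *m E') + p').
  + by move=> x y _ _; exact: (can_inj (fK _ _ _ _ K1)).
  + move=> _ [x _ <-]; exists (f p' p (G' *m E) (toR x)); last exact: fK.
    by rewrite fint; exists ((x - p') *m (G' *m E) + p).
apply/seteqP; split=> [_ [x Px <-]|x P'x]; first exact: framed_sub frP frP' PP' _ Px.
exists (f p' p (G' *m E) x); last exact: fK.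
exact: framed_sub frP' frP (esym PP') _ P'x.
Qed.

Lemma finitely_many_in_dimension (R : realType) (n d : nat) :
  exists T : set {d : nat & set 'rV[R]_d}, finite_set T /\
    (forall (e : nat) (Q : set 'rV[R]_e), T (existT _ e Q) ->
       smooth_lattice_polytope Q /\ has_lattice_points Q n) /\
    (forall P : set 'rV[R]_d, smooth_lattice_polytope P ->
       has_lattice_points P n -> exists Q : set 'rV[R]_d,
       T (existT _ d Q) /\ integrally_equivalent P Q).
Proof.
pose C := gap n n 1.
pose good (P : set 'rV[R]_d) :=
  smooth_lattice_polytope P /\ has_lattice_points P n.
pose coded c P := good P /\
  exists p E G, framed C P p E G /\ c = box_points C P p E.
pose D := [set c | exists P, coded c P].
(* One representative per attained code; [set0] is a default for the other codes. *)
have Dcoded c : exists Q, D c -> coded c Q.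
  by have [[P cP]|nD] := pselect (D c); [exists P|exists set0].
have [Q Qcoded] := boolp.choice Dcoded.
exists [set existT _ d (Q c) | c in D]; split; first exact: finite_image.
split.
  (* Quantifying over the pair [z] lets its equation be substituted without injectivity of
     [existT]. *)
  suff allgood (z : {e : nat & set 'rV[R]_e}) : [set existT _ d (Q c) | c in D] z ->
      smooth_lattice_polytope (projT2 z) /\ has_lattice_points (projT2 z) n.
    by move=> e Q' /allgood.
  by move=> [c /Qcoded[Qc _] <-].
move=> P Psmooth Pn; have [_ [p [E [G frP]]]] := smooth_framed Psmooth Pn.
pose c := box_points C P p E.
have Dc : D c by exists P; split=> //; exists p, E, G.
have [[[_ Qfull _] _] [p' [E' [G' [frQ cQ]]]]] := Qcoded _ Dc.
exists (Q c); split; first by exists c.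
by have [_ Pfull _] := Psmooth; exact: framed_equivalent frP frQ cQ.
Qed.

Theorem corollary11 (R : realType) (n : nat) :
  exists T : set {d : nat & set 'rV[R]_d},
    [/\ finite_set T,
        forall (d : nat) (Q : set 'rV[R]_d),
          T (existT _ d Q) ->
          smooth_lattice_polytope Q /\ has_lattice_points Q n
      & forall (d : nat) (P : set 'rV[R]_d),
          smooth_lattice_polytope P -> has_lattice_points P n ->
          exists (d' : nat) (Q : set 'rV[R]_d'),
            T (existT _ d' Q) /\ integrally_equivalent P Q].
Proof.
have [T TP] := boolp.choice (finitely_many_in_dimension R n).
exists (\bigcup_(d in `I_n.+1) T d); split.
- apply: bigcup_finite; first exact: finite_II.
  by move=> d _; have [] := TP d.
- by move=> e Q [d _]; have [_ [TdP _]] := TP d; exact: TdP.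
move=> d P Psmooth Pn; have [dn _] := smooth_framed Psmooth Pn.
have [_ [_ /(_ P Psmooth Pn)[Q [TQ PQ]]]] := TP d.
by exists d, Q; split=> //; exists d.
Qed.
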